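(* Let $\alpha$ be a type, let $A\subseteq\mathcal{P}(\mathrm{Node}_\alpha)$ be a set of constructions, let $r\subseteq\mathcal{P}(\mathrm{Node}_\alpha)\times\mathcal{P}(\mathrm{Node}_\alpha)$ be a binary relation on constructions, and let $M,N\in\mathcal{P}(\mathrm{Node}_\alpha)$. If $(M,N)\in r$ and $r\subseteq \mathrm{LListD\_Fun}\,(\mathrm{diag}\,A)\,r\ \cup\ \mathrm{diag}(\mathrm{LList}\,A)$, then $M=N$.
   Context: Setting: classical higher-order logic. $\mathbb{N}$ denotes the natural numbers including $0$; $\sigma+\tau$ is the disjoint sum type with injections $\mathrm{Inl},\mathrm{Inr}$. Nodes and trees: for a type $\alpha$, $\mathrm{Node}_\alpha$ is the type of pairs $(g,y)$ with $g:\mathbb{N}\to\mathbb{N}$, $y:\alpha+\mathbb{N}$, such that $g\,n=0$ for some $n$. A construction (tree) is an arbitrary set of nodes, i.e. an element of $\mathcal{P}(\mathrm{Node}_\alpha)$. For $k\in\mathbb{N}$ and $g:\mathbb{N}\to\mathbb{N}$, $\mathrm{Push}\,k\,g:\mathbb{N}\to\mathbb{N}$ is given by $(\mathrm{Push}\,k\,g)(0)=k+1$ and $(\mathrm{Push}\,k\,g)(j+1)=g(j)$. Define $M\cdot N=\{(\mathrm{Push}\,0\,g,y)\mid (g,y)\in M\}\cup\{(\mathrm{Push}\,1\,g,y)\mid (g,y)\in N\}$, $\mathrm{Numb}\,k=\{(\lambda i.0,\ \mathrm{Inr}\,k)\}$, $\mathrm{In0}\,M=\mathrm{Numb}\,0\cdot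 M$, $\mathrm{In1}\,N=\mathrm{Numb}\,1\cdot N$. Operators on sets of constructions: $A\otimes B=\{x\cdot y\mid x\in A,\ y\in B\}$ and $A\oplus B=\{\mathrm{In0}\,x\mid x\in A\}\cup\{\mathrm{In1}\,y\mid y\in B\}$. Operators on binary relations on constructions: $\mathrm{diag}\,A=\{(x,x)\mid x\in A\}$, $r\otimes_D s=\{(x\cdot y,\ x'\cdot y')\mid (x,x')\in r,\ (y,y')\in s\}$, and $r\oplus_D s=\{(\mathrm{In0}\,x,\mathrm{In0}\,x')\mid (x,x')\in r\}\cup\{(\mathrm{In1}\,y,\mathrm{In1}\,y')\mid (y,y')\in s\}$. Greatest fixedpoint: for an operator $F$ on subsets of a type, $\mathrm{gfp}\,F=\bigcup\{X\mid X\subseteq F\,X\}$. Lazy lists: $\mathrm{LList}\,A=\mathrm{gfp}(\lambda Z.\ \{\mathrm{Numb}\,0\}\oplus(A\otimes Z))$. Also, for a binary relation $s$ on constructions, $\mathrm{LListD\_Fun}\,s\,Z=\mathrm{diag}\{\mathrm{Numb}\,0\}\oplus_D(s\otimes_D Z)$. *)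

(* Defs.v *)
From mathcomp Require Import all_boot.
From mathcomp Require Import boolp classical_sets.

Set Implicit Arguments.
Unset Strict Implicit.
Unset Printing Implicit Defensive.

Local Open Scope classical_set_scope.

Definition gfp (T : Type) (F : set T -> set T) : set T :=
  \bigcup_(X in [set X | X `<=` F X]) X.

(* The condition "g n = 0 for some n" is a proposition, so two nodes with the
   same underlying pair are equal by proof irrelevance. *)
Definition Node (alpha : Type) : Type :=
  {p : (nat -> nat) * (alpha + nat) | exists n, p.1 n = 0}.

Definition construction (alpha : Type) : Type := set (Node alpha).

Definition Push (k : nat) (g : nat -> nat) : nat -> nat :=
  fun n => if n is j.+1 then g j else k.+1.

Lemma Push_node (alpha : Type) (k : nat) (p : Node alpha) :
  exists n, (Push k (sval p).1, (sval p).2).1 n = 0.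
Proof. by case: p => -[g y] /= [n gn0]; exists n.+1. Qed.

Definition push_Node (alpha : Type) (k : nat) (p : Node alpha) : Node alpha :=
  exist _ (Push k (sval p).1, (sval p).2) (Push_node k p).

(* M . N *)
Definition Scons (alpha : Type) (M N : construction alpha) :
    construction alpha :=
  [set push_Node 0 p | p in M] `|` [set push_Node 1 p | p in N].

Lemma const0_node (alpha : Type) (y : alpha + nat) :
  exists n, ((fun _ : nat => 0), y).1 n = 0.
Proof. by exists 0. Qed.

Definition Numb (alpha : Type) (k : nat) : construction alpha :=
  [set exist _ ((fun _ : nat => 0), inr k) (const0_node (inr k))].
Arguments Numb : clear implicits.

Definition In0 (alpha : Type) (M : construction alpha) : construction alpha :=
  Scons (Numb alpha 0) M.

Definition In1 (alpha : Type) (N : construction alpha) : construction alpha :=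
  Scons (Numb alpha 1) N.

(* A (x) B *)
Definition uprod (alpha : Type) (A B : set (construction alpha)) :
    set (construction alpha) :=
  [set Scons x y | x in A & y in B].

(* A (+) B *)
Definition usum (alpha : Type) (A B : set (construction alpha)) :
    set (construction alpha) :=
  [set In0 x | x in A] `|` [set In1 y | y in B].

Definition diag (T : Type) (A : set T) : set (T * T) :=
  [set (x, x) | x in A].

(* r (x)_D s *)
Definition dprod (alpha : Type)
    (r s : set (construction alpha * construction alpha)) :
    set (construction alpha * construction alpha) :=
  [set (Scons p.1 q.1, Scons p.2 q.2) | p in r & q in s].

(* r (+)_D s *)
Definition dsum (alpha : Type)
    (r s : set (construction alpha * construction alpha)) :
    set (construction alpha * construction alpha) :=
  [set (In0 p.1, In0 p.2) | p in r] `|` [set (In1 q.1, In1 q.2) | q in s].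

Definition LList (alpha : Type) (A : set (construction alpha)) :
    set (construction alpha) :=
  gfp (fun Z => usum [set Numb alpha 0] (uprod A Z)).

Definition LListD_Fun (alpha : Type)
    (s Z : set (construction alpha * construction alpha)) :
    set (construction alpha * construction alpha) :=
  dsum (diag [set Numb alpha 0]) (dprod s Z).

(* Main.v *)
Require Import Defs.
From mathcomp Require Import all_boot.
From mathcomp Require Import boolp classical_sets.

Local Open Scope classical_set_scope.

(** Since every node [(g, y)] has a zero of [g], a construction is determined by
its nodes of bounded depth.  [Scons] raises by one the depth up to which two
constructions agree, so related constructions, unfolded once by the
bisimulation, agree one level deeper; by induction they agree at every depth. *)

(** Any zero [m] of the node's function witnesses its depth; asking for the least one would give the
    same relation. *)
Definition agree_below {alpha : Type} (n : nat) (M N : construction alpha) :=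
  forall (p : Node alpha) m, m < n -> (sval p).1 m = 0 -> M p <-> N p.

Lemma agree_below_refl {alpha : Type} n (M : construction alpha) :
  agree_below n M M.
Proof. by []. Qed.

Lemma agree_below_leq {alpha : Type} m n (M N : construction alpha) :
  m <= n -> agree_below n M N -> agree_below m M N.
Proof. by move=> mn MN p k km; apply: MN; apply: leq_trans mn. Qed.

Lemma agree_below_eq {alpha : Type} (M N : construction alpha) :
  (forall n, agree_below n M N) -> M = N.
Proof.
move=> MN; apply/seteqP.
by split=> p; have [m pm0] := svalP p; apply (MN m.+1 p m (ltnSn m) pm0).
Qed.

(** [Push k g] is [k.+1] at 0, hence nonzero there, and its zero at [m.+1] is a zero of [g] at
    [m]. *)
Lemma agree_below_Scons {alpha : Type} n (M M' N N' : construction alpha) :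
  agree_below n M M' -> agree_below n N N' ->
  agree_below n.+1 (Scons M N) (Scons M' N').
Proof.
move=> MM' NN' p [|m]; rewrite ?ltnS => mn pm0.
  by split=> -[] [q _ qp]; rewrite -qp in pm0.
split=> -[] [q Xq qp]; rewrite -qp /= in pm0; [left|right|left|right];
  exists q => //.
- exact/(MM' q m mn pm0).
- exact/(NN' q m mn pm0).
- exact/(MM' q m mn pm0).
- exact/(NN' q m mn pm0).
Qed.

Lemma LListD_Fun_agree_below {alpha : Type} (A : set (construction alpha))
    (r : set (construction alpha * construction alpha)) n :
  (forall M N, r (M, N) -> agree_below n M N) ->
  forall M N, LListD_Fun (diag A) r (M, N) -> agree_below n.+1 M N.
Proof.
move=> rn M N [[_ [x _ <-] [<- <-]]|]; first exact: agree_below_refl.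
case=> _ [_ [a _ <-] [[y z] ryz <-]] [<- <-].
(* A cons cell is [In1] of a pair, so its tail lies under two [Scons] and agreement gains two
   levels. *)
apply: (@agree_below_leq _ _ n.+2) => //.
apply: agree_below_Scons; first exact: agree_below_refl.
by apply: agree_below_Scons; [exact: agree_below_refl | exact: rn].
Qed.

Theorem mainTheorem3 (alpha : Type) (A : set (construction alpha))
    (r : set (construction alpha * construction alpha))
    (M N : construction alpha) :
  r (M, N) ->
  r `<=` LListD_Fun (diag A) r `|` diag (LList A) ->
  M = N.
Proof.
move=> rMN r_bisim; apply: agree_below_eq => n.
(* The pair must vary: the induction hypothesis is applied to the tails. *)
elim: n M N rMN => [//|n IHn] M N /r_bisim[].
  exact: LListD_Fun_agree_below.
by case=> x _ [<- <-]; apply: agree_below_refl.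
Qed.
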